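(* Let $M=\langle S,(\sim_i)_{i\in\mathcal{A}}\rangle$ be a Beth-Kripke model and let $\Theta$ be one of its Beth models ($\Theta=\Theta_s$ for some $s\in S$). Then for every node $\alpha\in\Theta$, every agent $i\in\mathcal{A}$, and every formula $\varphi\in L(\mathcal{A},\mathbf{AT})$: (a) $\alpha\Vdash_M\varphi$ iff there is a bar $B$ for $\alpha$ such that $\beta\Vdash_M\varphi$ for all $\beta\in B$; (b) $\alpha\not\Vdash_M\varphi$ iff there is a path $P$ through $\alpha$ such that $\beta\not\Vdash_M\varphi$ for every $\beta\in P$; (c) if $\alpha\leq\beta$ and $\alpha\Vdash_M\varphi$, then $\beta\Vdash_M\varphi$; (d) if $\alpha\Vdash_M K_i\varphi$, then $\beta\Vdash_M K_i\varphi$ for all $\beta\in\Theta$.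
   Context: $\mathbf{AT}$ is a nonempty set of propositional atoms and $\mathcal{A}$ a set of agents. A Beth model is a triple $\Theta=\langle Q,\leq,F\rangle$ where $(Q,\leq)$ is a partial order with a least element (the root) and $F:Q\to 2^{\mathbf{AT}}$ satisfies $F(\alpha)\subseteq F(\beta)$ whenever $\alpha\leq\beta$; we write $\alpha\in\Theta$ for $\alpha\in Q$. A path through $\alpha$ is a maximal linearly ordered subset of $Q$ containing $\alpha$; a bar for $\alpha$ is a subset of $Q$ meeting every path through $\alpha$. The language $L(\mathcal{A},\mathbf{AT})$ is the smallest set containing $\mathbf{AT}$ and closed under $\neg,\wedge,\vee,\rightarrow$ and $K_i$ ($i\in\mathcal{A}$). A Beth-Kripke model is $M=\langle S,(\sim_i)_{i\in\mathcal{A}}\rangle$ where $S$ is a nonempty set of Beth models over $\mathbf{AT}$ (each $s\in S$ is a Beth model $\Theta_s$ with root $\alpha_s$) and each $\sim_i$ is a binary relation on $S$. For $\Theta\in S$ and $\alpha\in\Theta$, satisfaction is defined inductively: $\alpha\Vdash_M p$ ($p\in\mathbf{AT}$) iff there is a bar $B$ for $\alpha$ with $p\in F(\beta)$ for all $\beta\in B$; $\alpha\Vdash_M\varphi\wedge\psi$ iff $\alpha\Vdash_M\varphi$ and $\alpha\Vdash_M\psi$; $\alpha\Vdash_M\varphi\vee\psi$ iff there is a bar $B\subseteq\Theta$ for $\alpha$ such that each $\beta\in B$ satisfies $\beta\Vdash_M\varphi$ or $\beta\Vdash_M\psi$; $\alpha\Vdash_M\varphi\rightarrow\psi$ iff for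 every $\beta\geq\alpha$ in $\Theta$, $\beta\Vdash_M\varphi$ implies $\beta\Vdash_M\psi$; $\alpha\Vdash_M\neg\varphi$ iff $\beta\not\Vdash_M\varphi$ for every $\beta\geq\alpha$ in $\Theta$; $\alpha\Vdash_M K_i\varphi$ iff for every $\Omega\in S$ with $\Theta\sim_i\Omega$ and every $\beta\in\Omega$, $\beta\Vdash_M\varphi$. *)

(* Defs.v *)
From mathcomp Require Import all_boot all_order.
From mathcomp Require Import boolp classical_sets.

Set Implicit Arguments.
Unset Strict Implicit.
Unset Printing Implicit Defensive.

Local Open Scope classical_set_scope.
Local Open Scope order_scope.

(* The least element [\bot] of the frame is the root. *)
Record bethModel (AT : Type) : Type := BethModel {
  frame_disp : Order.disp_t;
  frame :> bPOrderType frame_disp;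
  atoms_at : frame -> set AT;
  atoms_at_mono : forall a b : frame, a <= b -> atoms_at a `<=` atoms_at b
}.

Section PathsAndBars.
Variables (d : Order.disp_t) (Q : porderType d).

Definition path_through (a : Q) (P : set Q) : Prop :=
  [/\ total_on P <=%O, P a &
      forall C : set Q, total_on C <=%O -> P `<=` C -> C `<=` P].

(* A bar for [a] may contain nodes that are not above [a]. *)
Definition bar_for (a : Q) (B : set Q) : Prop :=
  forall P : set Q, path_through a P -> B `&` P !=set0.

End PathsAndBars.

Inductive formula (A AT : Type) : Type :=
| Atom of AT
| Neg of formula A AT
| And of formula A AT & formula A AT
| Or of formula A AT & formula A AT
| Imp of formula A AT & formula A AT
| Know of A & formula A AT.

Arguments Atom {A AT}.

(* [worlds] is a plain predicate rather than a [set]: the universe of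
   [bethModel], which quantifies over ordered types, is too large for [set]. *)
Record bethKripkeModel (A AT : Type) : Type := BethKripkeModel {
  worlds : bethModel AT -> Prop;
  worlds_nonempty : exists T, worlds T;
  indist : A -> {T | worlds T} -> {T | worlds T} -> Prop
}.

Definition world (A AT : Type) (M : bethKripkeModel A AT) : Type :=
  {T | worlds M T}.

(* A node is always given together with the world [s] it belongs to, since
   distinct worlds may have the same underlying set of nodes. *)
Fixpoint forces (A AT : Type) (M : bethKripkeModel A AT)
    (s : world M) (a : sval s) (phi : formula A AT) {struct phi} : Prop :=
  match phi with
  | Atom p =>
      exists B : set (sval s), bar_for a B /\ forall b, B b -> atoms_at b p
  | Neg f => forall b : sval s, a <= b -> ~ forces b f
  | And f g => forces a f /\ forces a g
  | Or f g =>
      exists B : set (sval s), bar_for a B /\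
        forall b, B b -> forces b f \/ forces b g
  | Imp f g => forall b : sval s, a <= b -> forces b f -> forces b g
  | Know i f =>
      forall w : world M, indist i s w -> forall b : sval w, forces b f
  end.

Arguments forces {A AT} M s a phi.

(* Main.v *)
(* If [a <= b] and [P] is a path through [b], then the part of [P] above [b],
   together with [a], extends to a path [P'] through [a], and maximality of [P]
   forces the part of [P'] above [b] to lie in [P].  Hence a bar for [a] that is
   closed upwards and cut at [b] is a bar for [b].  Monotonicity (c) and then
   the covering property (a) follow by induction on the formula; (b) is the
   contrapositive of (a). *)
Require Import Defs.
From mathcomp Require Import all_boot all_order.
From mathcomp Require Import boolp classical_sets.
Import Order.TTheory.

Local Open Scope classical_set_scope.
Local Open Scope order_scope.

Section Paths.
Context {d : Order.disp_t} {Q : porderType d}.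
Implicit Types (a b c : Q) (B C D P : set Q).

Lemma chain_sub_path a C : total_on C <=%O -> C a ->
  exists P, path_through a P /\ C `<=` P.
Proof.
move=> Cchain Ca.
(* Zorn's lemma also asks about the empty family. Requiring that [X] united with [C] be a chain,
   rather than that [X] contain [C], makes that case the hypothesis on [C]. *)
pose ext X := total_on (X `|` C) (<=%O : rel Q).
have [F Fext Fchain|X [Xext Xmax]] := @Zorn_bigcup Q ext.
  move=> x y [[X FX Xx]|Cx] [[Y FY Yy]|Cy].
  - have [XY|YX] := Fchain _ _ FX FY.
      by apply: (Fext _ FY); left=> //; exact: XY.
    by apply: (Fext _ FX); left=> //; exact: YX.
  - by apply: (Fext _ FX); [left|right].
  - by apply: (Fext _ FY); [right|left].
  - exact: Cchain.
exists (X `|` C)%classic; split; last by move=> x; right.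
split=> //; first by right.
move=> D Dchain XCD x Dx; apply: contrapT => XCx.
apply: (Xmax D).
  by split=> [y Xy|DX]; [apply: XCD; left|apply: XCx; left; exact: DX].
rewrite /ext (_ : (D `|` C)%classic = D)//.
by apply/setUidPl => y Cy; apply: XCD; right.
Qed.

Lemma path_through_mem a b P : path_through a P -> P b -> path_through b P.
Proof. by case. Qed.

(** Since the chain [[set a]] extends to a path, being a bar is never vacuous. The negation and
    knowledge cases of [forces_bar] need an actual node of the bar. *)
Lemma bar_for_nonempty a B : bar_for a B -> B !=set0.
Proof.
move=> aB.
have [x y -> ->|//|P [aP _]] := @chain_sub_path a [set a]; first by left.
by have [x [Bx _]] := aB _ aP; exists x.
Qed.

Lemma bar_for_trans a B C :
  bar_for a B -> (forall b, B b -> bar_for b C) -> bar_for a C.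
Proof.
move=> aB BC P aP; have [b [Bb Pb]] := aB P aP.
exact: BC _ Bb P (path_through_mem _ _ _ aP Pb).
Qed.

Lemma bar_for_self a : bar_for a [set a].
Proof. by move=> P [_ Pa _]; exists a. Qed.

Lemma path_rebase a b P : a <= b -> path_through b P ->
  exists P', [/\ path_through a P', P' b & forall x, P' x -> b <= x -> P x].
Proof.
move=> ab [Pchain Pb Pmax].
pose C := ([set a] `|` (P `&` [set x | b <= x]))%classic.
have [||P' [aP' CP']] := @chain_sub_path a C; last first.
- have [P'chain _ _] := aP'.
  have P'b : P' b by apply: CP'; right; split=> //=.
  exists P'; split=> // x P'x bx.
  pose low := (P `&` [set y | y <= b])%classic.
  pose high := (P' `&` [set y | b <= y])%classic.
  (* The chain tested against maximality follows [P] up to [b] and [P'] from there on. It contains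
     [P] because every node of [P] is comparable with [b]. *)
  apply: (Pmax (low `|` high)%classic); last by right.
    move=> y z [[Py yb]|[P'y by_]] [[Pz zb]|[P'z bz]].
    + exact: Pchain.
    + by left; exact: le_trans bz.
    + by right; exact: le_trans by_.
    + exact: P'chain.
  move=> y Py; have [yb|by_] := Pchain _ _ Py Pb; first by left.
  by right; split=> //; apply: CP'; right.
- by left.
- move=> x y [->|[Px bx]] [->|[Py by_]].
  + by left.
  + by left; exact: le_trans by_.
  + by right; exact: le_trans bx.
  + exact: Pchain.
Qed.

Lemma bar_for_le a b B : a <= b -> bar_for a B ->
  bar_for b [set x | b <= x /\ exists2 y, B y & y <= x].
Proof.
move=> ab aB P bP; have [P' [aP' P'b P'P]] := path_rebase _ _ _ ab bP.
have [x [Bx P'x]] := aB P' aP'; have [P'chain _ _] := aP'.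
have [xb|bx] := P'chain _ _ P'x P'b.
  by exists b; split; [split=> //; exists x|case: bP].
by exists x; split; [split=> //; exists x|exact: P'P].
Qed.

End Paths.

Section Forcing.
Context {A AT : Type} {M : bethKripkeModel A AT} {s : world M}.
Implicit Types (a b : sval s) (phi : formula A AT).

Lemma forces_le phi a b : a <= b -> forces M s a phi -> forces M s b phi.
Proof.
elim: phi a b => [p|f _|f IHf g IHg|f IHf g IHg|f _ g _|i f _] a b ab /=.
- move=> [B [aB Bp]]; eexists; split; first exact: (bar_for_le _ _ _ ab aB).
  by move=> x [_ [y By yx]]; exact: (atoms_at_mono yx (Bp _ By)).
- by move=> af c bc; apply: af; exact: le_trans bc.
- by move=> [af ag]; split; [exact: IHf af|exact: IHg ag].
- move=> [B [aB Bfg]]; eexists; split; first exact: (bar_for_le _ _ _ ab aB).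
  move=> x [_ [y By yx]].
  by case: (Bfg _ By) => ?; [left; apply: IHf yx _|right; apply: IHg yx _].
- by move=> afg c bc; apply: afg; exact: le_trans bc.
(* Forcing of [Know] depends on the world only, not on the node. *)
- exact.
Qed.

Lemma forces_bar phi a :
  bar_for a [set b | forces M s b phi] -> forces M s a phi.
Proof.
elim: phi a => [p|f _|f IHf g IHg|f IHf g IHg|f _ g IHg|i f _] a aB /=.
- exists [set b | atoms_at b p]; split=> //.
  (* The local bars, one for each node of the given bar, are glued together inside a single set. *)
  apply: bar_for_trans aB _ => b [C [bC Cp]] P bP.
  by have [x [Cx Px]] := bC P bP; exists x; split=> //; exact: Cp.
- move=> b ab bf.
  (* Some [x] above [b] lies above a node [y] forcing the negation, yet [f] persists from [b] to
     [x]. *)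
  have [x [bx [y yf yx]]] := bar_for_nonempty _ _ (bar_for_le _ _ _ ab aB).
  exact: yf yx (forces_le _ _ _ bx bf).
- by split; [apply: IHf|apply: IHg] => P /aB [x [[? ?] Px]]; exists x.
- exists [set b | forces M s b f \/ forces M s b g]; split=> //.
  apply: bar_for_trans aB _ => b [C [bC Cfg]] P bP.
  by have [x [Cx Px]] := bC P bP; exists x; split=> //; exact: Cfg.
- move=> b ab bf; apply: IHg => P /(bar_for_le _ _ _ ab aB).
  move=> [x [[bx [y yfg yx]] Px]]; exists x; split=> //.
  exact: yfg yx (forces_le _ _ _ bx bf).
- by have [b] := bar_for_nonempty _ _ aB.
Qed.

End Forcing.

Theorem theorem3 (A AT : Type) (AT_nonempty : inhabited AT)
    (M : bethKripkeModel A AT) (s : world M) (a : sval s)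
    (phi : formula A AT) :
  [/\ (* (a) *)
      forces M s a phi <->
        exists B : set (sval s), bar_for a B /\ forall b, B b -> forces M s b phi,
      (* (b) *)
      ~ forces M s a phi <->
        exists P : set (sval s),
          path_through a P /\ forall b, P b -> ~ forces M s b phi,
      (* (c) *)
      forall b : sval s, a <= b -> forces M s a phi -> forces M s b phi &
      (* (d) *)
      forall i : A, forces M s a (Know i phi) ->
        forall b : sval s, forces M s b (Know i phi)].
Proof.
split.
- split=> [aphi|[B [aB Bphi]]].
    by exists [set a]; split; [exact: bar_for_self|move=> b ->].
  apply: forces_bar => P /aB [b [Bb Pb]].
  by exists b; split=> //; exact: Bphi.
- split=> [naphi|[P [[_ Pa _] Pphi]]]; last exact: Pphi.
  (* If no path avoids the nodes forcing [phi], these nodes form a bar. *)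
  apply: contrapT => noP; apply: naphi; apply: forces_bar => P aP.
  apply: contrapT => Pphi; apply: noP; exists P; split=> // b Pb bphi.
  by apply: Pphi; exists b.
- by move=> b; exact: forces_le.
- by [].
Qed.
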